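(* Let $f:\mathbb{R}^n\to\mathbb{R}$ be a piecewise-affine function with abs-normal form data $s,c,b,Z,L,J,Y$ (with $m=1$), and let $\tilde c,\tilde b,\tilde L,\tilde Y,\tilde Z,\tilde J$ be the associated auxiliary matrices and vectors. A point $x^\ast\in\mathbb{R}^n$ is a global minimum of $f$ (i.e. $f(x^\ast)\le f(x)$ for all $x\in\mathbb{R}^n$) if and only if there exists $w^\ast\in\mathbb{R}^s$ for which $(x^\ast,w^\ast)$ solves (is a globally optimal feasible point of) the linear program with complementarity constraints $$\min_{x\in\mathbb{R}^n,\;w\in\mathbb{R}^s}\ \tilde b+\tilde J x+\tilde Y w\qquad\text{subject to}\qquad 0\le w\perp \tilde c+\tilde Z x+\tilde L w\ge 0.$$
   Context: A function $f:\mathbb{R}^n\to\mathbb{R}^m$ is piecewise affine if it is continuous and its values are chosen from finitely many affine functions, i.e. there are finitely many affine maps $f^1,\dots,f^k$ with $f(x)\in\{f^1(x),\dots,f^k(x)\}$ for every $x$. For a vector $z$, $|z|$ denotes the componentwise absolute value; vector inequalities are componentwise. For vectors $p,q$ of the same size, $0\le p\perp q\ge 0$ means $p\ge0$, $q\ge0$ and $p^{T}q=0$. Abs-normal form: $f$ has abs-normal form data consisting of $s\in\mathbb{N}$, matrices $Z\in\mathbb{R}^{s\times n}$, $J\in\mathbb{R}^{m\times n}$, $Y\in\mathbb{R}^{m\times s}$, a strictly lower triangular matrix $L\in\mathbb{R}^{s\times s}$, and vectors $c\in\mathbb{R}^s$, $b\in\mathbb{R}^m$, if for every $x\in\mathbb{R}^n$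 the unique vector $z\in\mathbb{R}^s$ with $z=c+Zx+L|z|$ satisfies $f(x)=b+Jx+Y|z|$. Here $m=1$. Auxiliary quantities: $\tilde c:=(I-L)^{-1}c$, $\tilde b:=b+Y\tilde c$, $\tilde L:=(I-L)^{-1}(I+L)$, $\tilde Y:=Y(I+\tilde L)$, $\tilde Z:=(I-L)^{-1}Z$, $\tilde J:=J+Y\tilde Z$. ($I-L$ is unit lower triangular, hence invertible.) *)

(* Defs.v *)
From mathcomp Require Export all_boot all_order all_algebra.
From mathcomp Require Export boolp classical_sets reals topology normedtype.
Export Order.TTheory GRing.Theory Num.Theory.
Export numFieldNormedType.Exports.

#[export] Set Implicit Arguments.
#[export] Unset Strict Implicit.
#[export] Unset Printing Implicit Defensive.

#[global] Open Scope ring_scope.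

(* Componentwise absolute value; the library norm `|z| on matrices is the
   sup norm, which is a different notion. *)
Definition absv (R : realType) (s : nat) (z : 'cV[R]_s) : 'cV[R]_s :=
  map_mx (fun t : R => `|t|) z.

Definition lev (R : realType) (s : nat) (p q : 'cV[R]_s) : Prop :=
  forall i, p i 0 <= q i 0.

(* 0 <= p _|_ q >= 0 *)
Definition complementary (R : realType) (s : nat) (p q : 'cV[R]_s) : Prop :=
  [/\ lev 0 p, lev 0 q & p^T *m q = 0].

Definition piecewise_affine (R : realType) (n m : nat)
    (f : 'cV[R]_n -> 'cV[R]_m) : Prop :=
  continuous f /\
  exists (k : nat) (A : 'I_k -> 'M[R]_(m, n)) (d : 'I_k -> 'cV[R]_m),
    forall x, exists i, f x = A i *m x + d i.

Definition strictly_lower (R : realType) (s : nat) (L : 'M[R]_s) : Prop :=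
  forall i j : 'I_s, (i <= j)%N -> L i j = 0.

Definition switching (R : realType) (n s : nat) (c : 'cV[R]_s)
    (Z : 'M[R]_(s, n)) (L : 'M[R]_s) (x : 'cV[R]_n) (z : 'cV[R]_s) : Prop :=
  z = c + Z *m x + L *m absv z.

(* Existence and uniqueness of z is not assumed below: it follows from the
   strict lower triangularity of L, see [switching_unique]. *)
Definition abs_normal_form (R : realType) (n m s : nat)
    (f : 'cV[R]_n -> 'cV[R]_m) (c : 'cV[R]_s) (b : 'cV[R]_m)
    (Z : 'M[R]_(s, n)) (L : 'M[R]_s) (J : 'M[R]_(m, n)) (Y : 'M[R]_(m, s)) :
    Prop :=
  strictly_lower L /\
  forall x z, switching c Z L x z -> f x = b + J *m x + Y *m absv z.

Lemma switching_unique (R : realType) (n s : nat) (c : 'cV[R]_s)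
    (Z : 'M[R]_(s, n)) (L : 'M[R]_s) (x : 'cV[R]_n) :
  strictly_lower L -> exists! z, switching c Z L x z.
Proof.
move=> HL; pose F z := c + Z *m x + L *m absv z.
have step k (u v : 'cV[R]_s) : (forall i : 'I_s, (i < k)%N -> u i 0 = v i 0) ->
    forall i : 'I_s, (i < k.+1)%N -> F u i 0 = F v i 0.
  move=> uv i ik; rewrite !mxE; congr (_ + _); apply: eq_bigr => j _.
  rewrite !mxE; case: (leqP i j) => [ij|ji]; first by rewrite HL // !mul0r.
  by rewrite uv // (leq_trans ji).
have iterE k (u v : 'cV[R]_s) (i : 'I_s) : (i < k)%N ->
    iter k F u i 0 = iter k F v i 0.
  by elim: k i => [//|k IH] i; apply: step => {}i; apply: IH.
have iter_eq (u v : 'cV[R]_s) : iter s F u = iter s F v.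
  by apply/matrixP => i j; rewrite ord1; apply: iterE; apply: ltn_ord.
exists (iter s F 0); split.
  by rewrite /switching -/(F _) -iterS iterSr; apply: iter_eq.
move=> z Hz; rewrite (iter_eq 0 z).
have Fz : F z = z by rewrite /F -Hz.
have iterz k : iter k F z = z by elim: k => //= k ->.
exact: iterz.
Qed.

Section Auxiliary.
Context (R : realType) (n m s : nat).
Implicit Types (c : 'cV[R]_s) (b : 'cV[R]_m) (Z : 'M[R]_(s, n))
  (L : 'M[R]_s) (J : 'M[R]_(m, n)) (Y : 'M[R]_(m, s)).

Definition c_tilde L c : 'cV[R]_s := invmx (1%:M - L) *m c.
Definition b_tilde L c b Y : 'cV[R]_m := b + Y *m c_tilde L c.
Definition L_tilde L : 'M[R]_s := invmx (1%:M - L) *m (1%:M + L).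
Definition Y_tilde L Y : 'M[R]_(m, s) := Y *m (1%:M + L_tilde L).
Definition Z_tilde L Z : 'M[R]_(s, n) := invmx (1%:M - L) *m Z.
Definition J_tilde L Z J Y : 'M[R]_(m, n) := J + Y *m Z_tilde L Z.

End Auxiliary.

(* [invmx A] is A itself when A is singular; this rules that case out. *)
Lemma strictly_lower_unit (R : realType) (s : nat) (L : 'M[R]_s) :
  strictly_lower L -> 1%:M - L \in unitmx.
Proof.
move=> HL; rewrite unitmxE det_trig; last first.
  apply/is_trig_mxP => i j ij; rewrite !mxE (HL _ _ (ltnW ij)) subr0.
  by rewrite -val_eqE /= (ltn_eqF ij).
by rewrite big1 ?unitr1 // => i _; rewrite !mxE eqxx HL ?subr0.
Qed.

Definition global_min (R : realType) (n : nat) (f : 'cV[R]_n -> R)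
    (xs : 'cV[R]_n) : Prop :=
  forall x, f xs <= f x.

(* The problem: min b + J x + Y w  s.t.  0 <= w _|_ c + Z x + L w >= 0. *)
Definition lpcc_feasible (R : realType) (n s : nat) (c : 'cV[R]_s)
    (Z : 'M[R]_(s, n)) (L : 'M[R]_s) (x : 'cV[R]_n) (w : 'cV[R]_s) : Prop :=
  complementary w (c + Z *m x + L *m w).

Definition lpcc_objective (R : realType) (n s : nat) (b : 'cV[R]_1)
    (J : 'rV[R]_n) (Y : 'rV[R]_s) (x : 'cV[R]_n) (w : 'cV[R]_s) : R :=
  (b + J *m x + Y *m w) 0 0.

Definition lpcc_solution (R : realType) (n s : nat) (b : 'cV[R]_1)
    (J : 'rV[R]_n) (Y : 'rV[R]_s) (c : 'cV[R]_s) (Z : 'M[R]_(s, n))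
    (L : 'M[R]_s) (xs : 'cV[R]_n) (ws : 'cV[R]_s) : Prop :=
  lpcc_feasible c Z L xs ws /\
  forall x w, lpcc_feasible c Z L x w ->
    lpcc_objective b J Y xs ws <= lpcc_objective b J Y x w.

(* Main.v *)
Require Import Defs.
From mathcomp Require Import lra.

(* Split z into u = z^+ and w = z^-, so that z = u - w, |z| = u + w and u, w
   are complementary.  Substituted into z = c + Z x + L |z| this gives
   (I - L) u = c + Z x + (I + L) w, that is u = c~ + Z~ x + L~ w, and the
   value b + J x + Y (u + w) becomes the objective.  Hence every x extends to
   a feasible (x, w), and the objective equals f x at each feasible (x, w). *)

Lemma complementary_mul0 (R : realType) (s : nat) (p q : 'cV[R]_s) :
  complementary p q -> forall i, p i 0 * q i 0 = 0.
Proof.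
move=> [p0 q0 /matrixP /(_ 0 0)]; rewrite !mxE => pq0 i.
have := @psumr_eq0P R 'I_s predT (fun i => p i 0 * q i 0); apply=> // [j _|].
  by have := p0 j; have := q0 j; rewrite !mxE => *; rewrite mulr_ge0.
by rewrite -[RHS]pq0; apply: eq_bigr => j _; rewrite !mxE.
Qed.

(** In each coordinate one of [p], [q] vanishes, and the other, being nonnegative, is its own
    absolute value. *)
Lemma complementary_absv (R : realType) (s : nat) (p q : 'cV[R]_s) :
  complementary p q -> absv (q - p) = q + p.
Proof.
move=> pq; have [p0 q0 _] := pq; apply/matrixP => i j; rewrite ord1 !mxE.
have := p0 i; have := q0 i; rewrite !mxE => qi pi.
have /eqP := complementary_mul0 pq i.
by rewrite mulf_eq0 => /orP[] /eqP ->; rewrite ?subr0 ?addr0 ?sub0r ?add0r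
  ?normrN ger0_norm.
Qed.

Lemma complementary_parts (R : realType) (s : nat) (z : 'cV[R]_s) :
  exists p q, [/\ complementary p q, z = q - p & absv z = q + p].
Proof.
(* The negative and positive parts of [z]. *)
exists (2^-1 *: (absv z - z)), (2^-1 *: (absv z + z)); split.
- split=> [i|i|]; first by rewrite !mxE; have := ler_norm (z i 0); lra.
    by rewrite !mxE; have := ler_norm (- z i 0); rewrite normrN; lra.
  (* According to the sign of [z k 0], one of the two factors is zero. *)
  apply/matrixP => i j; rewrite !ord1 !mxE big1 // => k _; rewrite !mxE.
  by case: (ger0P (z k 0)) => _; rewrite ?subrr ?addNr !(mulr0, mul0r).
- by apply/matrixP => i j; rewrite !mxE; lra.
- by apply/matrixP => i j; rewrite !mxE; lra.
Qed.

Lemma tilde_slackE (R : realType) (n s : nat) (c : 'cV[R]_s)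
    (Z : 'M[R]_(s, n)) (L : 'M[R]_s) (x : 'cV[R]_n) (w : 'cV[R]_s) :
  c_tilde L c + Z_tilde L Z *m x + L_tilde L *m w =
  invmx (1%:M - L) *m (c + Z *m x + (1%:M + L) *m w).
Proof.
by rewrite /c_tilde /Z_tilde /L_tilde [RHS]mulmxDr [in RHS]mulmxDr !mulmxA.
Qed.

(** Both equations rearrange to [(1%:M - L) *m u = c + Z *m x + (1%:M + L) *m w], since [1%:M - L]
    is invertible. *)
Lemma slack_switchingP (R : realType) (n s : nat) (c : 'cV[R]_s)
    (Z : 'M[R]_(s, n)) (L : 'M[R]_s) (x : 'cV[R]_n) (u w : 'cV[R]_s) :
  strictly_lower L ->
  u = c_tilde L c + Z_tilde L Z *m x + L_tilde L *m w <->
  u - w = c + Z *m x + L *m (u + w).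
Proof.
move=> /strictly_lower_unit LU; rewrite tilde_slackE.
have E : u - w = c + Z *m x + L *m (u + w) <->
    (1%:M - L) *m u = c + Z *m x + (1%:M + L) *m w.
  rewrite mulmxBl mulmxDl !mul1mx mulmxDr; split=> /matrixP H;
  by apply/matrixP => i j; have := H i j; rewrite !mxE; lra.
rewrite E; split=> [->|<-]; first by rewrite mulKVmx.
by rewrite mulKmx.
Qed.

(** The vector multiplied by [Y] on the right is the slack plus [w], which plays the role of
    [absv z]. *)
Lemma tilde_valueE (R : realType) (n m s : nat) (c : 'cV[R]_s) (b : 'cV[R]_m)
    (Z : 'M[R]_(s, n)) (L : 'M[R]_s) (J : 'M[R]_(m, n)) (Y : 'M[R]_(m, s))
    (x : 'cV[R]_n) (w : 'cV[R]_s) :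
  b_tilde L c b Y + J_tilde L Z J Y *m x + Y_tilde L Y *m w =
  b + J *m x +
  Y *m (c_tilde L c + Z_tilde L Z *m x + L_tilde L *m w + w).
Proof.
rewrite /b_tilde /J_tilde /Y_tilde mulmxDl !mulmxDr !mulmxDl mulmx1 !mulmxA.
by apply/matrixP => i j; rewrite !mxE; lra.
Qed.

Lemma lpcc_feasible_value (R : realType) (n s : nat) (f : 'cV[R]_n -> R)
    (c : 'cV[R]_s) (b : 'cV[R]_1) (Z : 'M[R]_(s, n)) (L : 'M[R]_s)
    (J : 'rV[R]_n) (Y : 'rV[R]_s) (x : 'cV[R]_n) (w : 'cV[R]_s) :
  abs_normal_form (fun x => (f x)%:M) c b Z L J Y ->
  lpcc_feasible (c_tilde L c) (Z_tilde L Z) (L_tilde L) x w ->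
  lpcc_objective (b_tilde L c b Y) (J_tilde L Z J Y) (Y_tilde L Y) x w = f x.
Proof.
move=> [HL fE] /complementary_absv; rewrite /lpcc_objective tilde_valueE.
set u := c_tilde L c + _ + _ => absE.
(* Complementarity makes [u + w] the absolute value of [u - w], so the slack equation becomes the
   switching equation. *)
have /(fE x) : switching c Z L x (u - w).
  by rewrite /switching absE; apply/slack_switchingP.
by rewrite absE => <-; rewrite mxE eqxx.
Qed.

Lemma lpcc_feasible_exists (R : realType) (n s : nat) (c : 'cV[R]_s)
    (Z : 'M[R]_(s, n)) (L : 'M[R]_s) (x : 'cV[R]_n) :
  strictly_lower L ->
  exists w, lpcc_feasible (c_tilde L c) (Z_tilde L Z) (L_tilde L) x w.
Proof.
move=> HL; have [z [zE _]] := switching_unique c Z x HL.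
have [w [u [wu z_uw absz]]] := complementary_parts z.
exists w; rewrite /lpcc_feasible.
(* The positive part [u] of [z] is exactly the slack at [w], so feasibility is the complementarity
   of the two parts. *)
have/(slack_switchingP c Z x u w HL) <- // : u - w = c + Z *m x + L *m (u + w).
by rewrite -absz -z_uw.
Qed.

(* f is real valued; the general definitions for maps into 'cV_m are used at
   m = 1 through the identification t |-> t%:M of R with 'cV[R]_1. *)
Theorem theorem4p1 (R : realType) (n s : nat) (f : 'cV[R]_n -> R)
    (c : 'cV[R]_s) (b : 'cV[R]_1) (Z : 'M[R]_(s, n)) (L : 'M[R]_s)
    (J : 'rV[R]_n) (Y : 'rV[R]_s)
    (f_pa : piecewise_affine (fun x => (f x)%:M : 'cV[R]_1))
    (f_anf : abs_normal_form (fun x => (f x)%:M) c b Z L J Y)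
    (xs : 'cV[R]_n) :
  global_min f xs <->
  exists ws : 'cV[R]_s,
    lpcc_solution (b_tilde L c b Y) (J_tilde L Z J Y) (Y_tilde L Y)
      (c_tilde L c) (Z_tilde L Z) (L_tilde L) xs ws.
Proof.
have [HL _] := f_anf; split=> [xs_min | [ws [ws_feas ws_opt]] x].
  have [ws ws_feas] := lpcc_feasible_exists c Z xs HL.
  exists ws; split=> // x w w_feas.
  (* Both objective values are values of [f], whichever feasible [ws] was chosen. *)
  by rewrite !(lpcc_feasible_value f_anf).
have [w w_feas] := lpcc_feasible_exists c Z x HL.
by have := ws_opt x w w_feas; rewrite !(lpcc_feasible_value f_anf).
Qed.
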